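(* Let $\mathbb K$ be a field of characteristic $2$, let $(\mathfrak g,[\cdot,\cdot]_{\mathfrak g},s_{\mathfrak g})$ be a finite-dimensional Lie superalgebra over $\mathbb K$, and suppose that a Lie superalgebra structure $(\mathfrak g^*,[\cdot,\cdot]_{\mathfrak g^*},s_{\mathfrak g^*})$ is also given on the dual space $\mathfrak g^*$. On $\mathfrak h:=\mathfrak g\oplus\mathfrak g^*$ consider the even bilinear form $$\mathscr B_{\mathfrak h}(x+f,y+g)=g(x)+f(y)\qquad (x,y\in\mathfrak g,\ f,g\in\mathfrak g^* ).$$ Suppose that the following three conditions hold: (1) $s_{\mathfrak g}(x)\circ \mathrm{ad}_h=[x,x\circ \mathrm{ad}_h]_{\mathfrak g}+x\circ \mathrm{ad}_{h\circ \mathrm{ad}_x}$ for all $x\in\mathfrak g_{\bar 1}$ and $h\in\mathfrak g^*$; (2) $s_{\mathfrak g^*}(f)\circ \mathrm{ad}_y=[f,f\circ \mathrm{ad}_y]_{\mathfrak g^*}+f\circ \mathrm{ad}_{y\circ \mathrm{ad}_f}$ for all $y\in\mathfrak g$ and $f\in\mathfrak g^*_{\bar 1}$; (3) $[x\circ \mathrm{ad}_f,y]_{\mathfrak g}=y\circ \mathrm{ad}_{f\circ \mathrm{ad}_x}+[x,y\circ \mathrm{ad}_f]_{\mathfrak g}+x\circ \mathrm{ad}_{f\circ \mathrm{ad}_y}+[x,y]_{\mathfrak g}\circ \mathrm{ad}_f$ for all $x,y\in\mathfrak g_{\bar 0}$, $f\in\mathfrak g^*$; and for all $x\in\mathfrak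 g_{\bar 0}$, $y\in\mathfrak g$, $f\in\mathfrak g^*_{\bar 0}$; and for all $x\in\mathfrak g_{\bar 1}$, $y\in\mathfrak g$, $f\in\mathfrak g^*_{\bar 1}$. Then there exists a unique Lie superalgebra structure on $\mathfrak h$ that extends the given structures on $\mathfrak g$ and $\mathfrak g^*$ and for which $(\mathfrak h,\mathscr B_{\mathfrak h})$ is a NIS-Lie superalgebra. Explicitly, for all $x,y\in\mathfrak g$ and $f,h\in\mathfrak g^*$, $$[x+f,y+h]_{\mathfrak h}=[x,y]_{\mathfrak g}+y\circ \mathrm{ad}_f+x\circ \mathrm{ad}_h+[f,h]_{\mathfrak g^*}+f\circ \mathrm{ad}_y+h\circ \mathrm{ad}_x,$$ and for all $x\in\mathfrak g_{\bar 1}$, $f\in\mathfrak g^*_{\bar 1}$, $$s_{\mathfrak h}(x+f)=s_{\mathfrak g}(x)+s_{\mathfrak g^*}(f)+f\circ \mathrm{ad}_x+x\circ \mathrm{ad}_f.$$ The bilinear form $\mathscr B_{\mathfrak h}$ is even and $\mathrm{ad}_{\mathfrak h}$-invariant.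
   Context: A Lie superalgebra in characteristic $2$ is a superspace $\mathfrak g=\mathfrak g_{\bar 0}\oplus\mathfrak g_{\bar 1}$ such that $\mathfrak g_{\bar 0}$ is a Lie algebra, $\mathfrak g_{\bar 1}$ is a $\mathfrak g_{\bar 0}$-module made two-sided by symmetry, together with a squaring $s_{\mathfrak g}:\mathfrak g_{\bar 1}\to\mathfrak g_{\bar 0}$ with $s_{\mathfrak g}(\lambda x)=\lambda^2 s_{\mathfrak g}(x)$ such that $[x,y]_{\mathfrak g}:=s_{\mathfrak g}(x+y)-s_{\mathfrak g}(x)-s_{\mathfrak g}(y)$ is bilinear on $\mathfrak g_{\bar 1}$ (this is the bracket of odd elements), and $[s_{\mathfrak g}(x),y]_{\mathfrak g}=[x,[x,y]_{\mathfrak g}]_{\mathfrak g}$ for all $x\in\mathfrak g_{\bar 1}$, $y\in\mathfrak g$. Notation: for $x\in\mathfrak g$ and $f\in\mathfrak g^*$, $f\circ \mathrm{ad}_x\in\mathfrak g^*$ is the functional $y\mapsto f([x,y]_{\mathfrak g})$, and $x\circ \mathrm{ad}_f\in\mathfrak g$ is the element determined (via $\mathfrak g\cong\mathfrak g^{**}$) by $h(x\circ \mathrm{ad}_f)=[f,h]_{\mathfrak g^*}(x)$ for all $h\in\mathfrak g^*$. A bilinear form $\mathscr B$ on $\mathfrak h$ is invariant if $\mathscr B([x,y],z)=\mathscr B(x,[y,z])$ for all $x,y,z$. A NIS-Lie superalgebra is a Lie superalgebra with a non-degenerate invariant bilinear form that is $\bar 0$-antisymmetric, i.e. $\mathscr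 B(x,y)=\mathscr B(y,x)$ for all $x,y$ and $\mathscr B(x,x)=0$ for all odd $x$. *)

(* Defs.v *)
From HB Require Import structures.
From mathcomp Require Import all_boot all_order all_algebra.

Set Implicit Arguments.
Unset Strict Implicit.
Unset Printing Implicit Defensive.

Import GRing.Theory.
Local Open Scope ring_scope.

Record superspace (K : fieldType) := Superspace {
  carrier :> vectType K;
  even_part : {vspace carrier};
  odd_part : {vspace carrier};
  even_odd_full : (even_part + odd_part)%VS = fullv;
  even_odd_cap : (even_part :&: odd_part)%VS = 0%VS
}.
Arguments even_part {K}.
Arguments odd_part {K}.

(* Only the values of [sq] on the odd part carry information: elsewhere it is
   an arbitrary function, which [same_lie_super] below ignores.  The bracket of two
   odd elements is forced by [sq_polar], its bilinearity being part of the type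
   of [br].  A Lie algebra in characteristic 2 has an alternating bracket. *)
Record lie_super (K : fieldType) (V : superspace K) := LieSuper {
  br : {bilinear V -> V -> V};
  sq : V -> V;
  br_even : forall x y,
    x \in even_part V -> y \in even_part V -> br x y \in even_part V;
  br_alt : forall x, x \in even_part V -> br x x = 0;
  br_jacobi : forall x y z,
    x \in even_part V -> y \in even_part V -> z \in even_part V ->
    br x (br y z) + br y (br z x) + br z (br x y) = 0;
  br_odd : forall x v,
    x \in even_part V -> v \in odd_part V -> br x v \in odd_part V;
  br_module : forall x y v,
    x \in even_part V -> y \in even_part V -> v \in odd_part V ->
    br (br x y) v = br x (br y v) - br y (br x v);
  br_two_sided : forall x v,
    x \in even_part V -> v \in odd_part V -> br v x = br x v;
  sq_even : forall x, x \in odd_part V -> sq x \in even_part V;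
  sqZ : forall (a : K) x, x \in odd_part V -> sq (a *: x) = a ^+ 2 *: sq x;
  sq_polar : forall x y, x \in odd_part V -> y \in odd_part V ->
    br x y = sq (x + y) - sq x - sq y;
  sq_ad : forall x y, x \in odd_part V -> br (sq x) y = br x (br x y)
}.

Definition same_lie_super (K : fieldType) (V : superspace K) (L L' : lie_super V) :=
  (forall x y, br L x y = br L' x y) /\
  (forall x, x \in odd_part V -> sq L x = sq L' x).

Section Forms.
Variables (K : fieldType) (V : superspace K).
Implicit Types (L : lie_super V) (B : {biscalar V}).

Definition even_form B :=
  forall x y, x \in even_part V -> y \in odd_part V -> B x y = 0 /\ B y x = 0.

Definition invariant_form L B :=
  forall x y z, B (br L x y) z = B x (br L y z).

Definition nondegenerate_form B :=
  (forall x, (forall y, B x y = 0) -> x = 0) /\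
  (forall y, (forall x, B x y = 0) -> y = 0).

Definition even_antisymmetric B :=
  (forall x y, B x y = B y x) /\ (forall x, x \in odd_part V -> B x x = 0).

Definition NIS L B :=
  [/\ nondegenerate_form B, invariant_form L B & even_antisymmetric B].

End Forms.

Section LinearDual.
Variables (K : fieldType) (V : vectType K).
Implicit Types (f : 'Hom(V, K^o)) (x : V) (U W : {vspace V}).

Definition dual_eval x f : K^o := f x.

Fact dual_eval_linear x : linear (dual_eval x).
Proof. by move=> a f g; rewrite /dual_eval !lfunE /= lfunE. Qed.
HB.instance Definition _ x :=
  GRing.isLinear.Build K 'Hom(V, K^o) K^o _ (dual_eval x) (dual_eval_linear x).

Definition bidual x : 'Hom('Hom(V, K^o), K^o) := linfun (dual_eval x).

Lemma bidualE x f : bidual x f = f x.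
Proof. by rewrite lfunE. Qed.

Fact bidual_linear : linear bidual.
Proof.
move=> a x y; apply/lfunP=> f.
by rewrite add_lfunE scale_lfunE !bidualE linearP.
Qed.
HB.instance Definition _ :=
  GRing.isLinear.Build K V 'Hom('Hom(V, K^o), K^o) _ bidual bidual_linear.

Definition ann U : {vspace 'Hom(V, K^o)} :=
  (\bigcap_(u <- vbasis U) lker (bidual u))%VS.

Lemma annP U f : reflect {in U, forall x, f x = 0} (f \in ann U).
Proof.
have -> : (f \in ann U) = all (fun u => f u == 0) (vbasis U).
  rewrite /ann; elim: (tval (vbasis U)) => [|u s IH] /=.
    by rewrite big_nil memvf.
  by rewrite big_cons memv_cap memv_ker bidualE IH.
apply: (iffP allP) => [f0 x Ux | f0 u su]; last first.
  by apply/eqP/f0/vbasis_mem.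
rewrite (coord_vbasis Ux) linear_sum big1 // => i _.
by rewrite linearZ /= (eqP (f0 _ (mem_nth _ _))) ?scaler0 // size_tuple.
Qed.

Lemma bidual_inj : injective bidual.
Proof.
move=> x y exy; apply/eqP; rewrite -subr_eq0; apply/eqP.
rewrite (coord_vbasis (memvf (x - y))) big1 // => i _.
have := congr1 (fun h : 'Hom('Hom(V, K^o), K^o) =>
  h (linfun (coord (vbasis {:V}) i : V -> K^o))) exy.
by rewrite !bidualE !lfunE /= linearB /= => ->; rewrite subrr scale0r.
Qed.

Lemma dim_dual (U : vectType K) : dim 'Hom(U, K^o) = dim U.
Proof. by rewrite -[LHS]/(dim U * 1)%N muln1. Qed.

Lemma lker_bidual : lker (linfun bidual) == 0%VS.
Proof. by apply/lker0P => x y; rewrite !lfunE; apply: bidual_inj. Qed.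

Lemma limg_bidual : limg (linfun bidual) = fullv.
Proof.
apply/eqP; rewrite eqEdim subvf limg_dim_eq ?(eqP lker_bidual) ?capv0 //.
by rewrite !dimvf !dim_dual leqnn.
Qed.

End LinearDual.

(* A functional is even when it vanishes on the odd part, odd when it vanishes
   on the even part. *)
Section DualSuperspace.
Variables (K : fieldType) (V : superspace K).

Fact dual_full : (ann (odd_part V) + ann (even_part V))%VS =
  fullv :> {vspace 'Hom(V, K^o)}.
Proof.
apply/vspaceP=> f; rewrite memvf.
pose p := daddv_pi (even_part V) (odd_part V).
pose q := daddv_pi (odd_part V) (even_part V).
have cap := even_odd_cap V; have cap' := cap; rewrite capvC in cap'.
have -> : f = ((f \o p) + (f \o q))%VF.
  apply/lfunP=> x; rewrite add_lfunE !comp_lfunE -linearD /=.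
  by rewrite daddv_pi_add // even_odd_full memvf.
apply: memv_add; apply/annP=> x xV; rewrite comp_lfunE.
  have : p x + q x = x by rewrite daddv_pi_add // even_odd_full memvf.
  rewrite [q x](daddv_pi_id cap') // => /(canRL (addrK _)).
  by rewrite subrr => ->; rewrite linear0.
have : p x + q x = x by rewrite daddv_pi_add // even_odd_full memvf.
rewrite [p x](daddv_pi_id cap) // => /(canRL (addKr _)).
by rewrite addNr => ->; rewrite linear0.
Qed.

Fact dual_cap : (ann (odd_part V) :&: ann (even_part V))%VS = 0%VS.
Proof.
apply/eqP; rewrite -subv0; apply/subvP=> f; rewrite memv_cap memv0.
case/andP=> /annP f1 /annP f0; apply/eqP/lfunP=> x; rewrite lfunE /=.
have /memv_addP[y y0 [z z1 ->]] : x \in (even_part V + odd_part V)%VS.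
  by rewrite even_odd_full memvf.
by rewrite linearD /= f0 // f1 // addr0.
Qed.

Definition dual_superspace : superspace K := Superspace dual_full dual_cap.

End DualSuperspace.

Section DirectSum.
Variables (K : fieldType).

Definition prodv (V W : vectType K) (U : {vspace V}) (U' : {vspace W}) :
  {vspace (V * W)%type} :=
  (linfun (fst : V * W -> V) @^-1: U :&: linfun (snd : V * W -> W) @^-1: U')%VS.

Lemma mem_prodv (V W : vectType K) (U : {vspace V}) (U' : {vspace W}) u :
  (u \in prodv U U') = (u.1 \in U) && (u.2 \in U').
Proof. by rewrite memv_cap -!memv_preim !lfunE. Qed.

Variables V W : superspace K.

Fact sum_full :
  (prodv (even_part V) (even_part W) + prodv (odd_part V) (odd_part W))%VS =
  fullv :> {vspace (V * W)%type}.
Proof.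
apply/vspaceP=> -[x y]; rewrite memvf.
have /memv_addP[x0 x00 [x1 x11 ->]] : x \in (even_part V + odd_part V)%VS.
  by rewrite even_odd_full memvf.
have /memv_addP[y0 y00 [y1 y11 ->]] : y \in (even_part W + odd_part W)%VS.
  by rewrite even_odd_full memvf.
have -> : (x0 + x1, y0 + y1) = (x0, y0) + (x1, y1) by [].
by apply: memv_add; rewrite mem_prodv /=; apply/andP.
Qed.

Fact sum_cap :
  (prodv (even_part V) (even_part W) :&: prodv (odd_part V) (odd_part W))%VS =
  0%VS.
Proof.
apply/eqP; rewrite -subv0; apply/subvP=> -[x y].
rewrite memv_cap !mem_prodv memv0 /= => /andP[/andP[x0 y0] /andP[x1 y1]].
have : x \in (even_part V :&: odd_part V)%VS by rewrite memv_cap x0.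
have : y \in (even_part W :&: odd_part W)%VS by rewrite memv_cap y0.
by rewrite !even_odd_cap !memv0 => /eqP -> /eqP ->.
Qed.

Definition sum_superspace : superspace K := Superspace sum_full sum_cap.

End DirectSum.

Section Coadjoint.
Variables (K : fieldType) (g : superspace K).
Variables (L : lie_super g) (L' : lie_super (dual_superspace g)).

(* [coad L f x] is the functional f o ad_x. *)
Definition coad (f : dual_superspace g) (x : g) : dual_superspace g :=
  (f \o linfun (br L x))%VF.

Lemma coadE (f : 'Hom(g, K^o)) x y :
  (coad f x : 'Hom(g, K^o)) y = f (br L x y).
Proof. by rewrite comp_lfunE lfunE. Qed.

(* [coad_dual L' x f] is the vector x o ad_f: the functional
   h |-> [f, h](x) on the dual is transported by the inverse of the canonical
   isomorphism onto the bidual. *)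
Definition coad_dual (x : g) (f : dual_superspace g) : g :=
  (linfun (@bidual K g))^-1%VF (bidual x \o linfun (br L' f))%VF.

Lemma coad_dualE x (f h : 'Hom(g, K^o)) :
  h (coad_dual x f) = (br L' f h : 'Hom(g, K^o)) x.
Proof.
rewrite -[LHS]bidualE -[bidual _](lfunE (@bidual K g)).
rewrite limg_lfunVK ?limg_bidual ?memvf //.
by rewrite comp_lfunE bidualE lfunE.
Qed.

End Coadjoint.

Section Double.
Variables (K : fieldType) (g : superspace K).

Definition double_superspace : superspace K :=
  sum_superspace g (dual_superspace g).

Definition double_form (u v : double_superspace) : K :=
  (v.2 : 'Hom(g, K^o)) u.1 + (u.2 : 'Hom(g, K^o)) v.1.

Fact double_form_bilinear : bilinear_for *%R *%R double_form.
Proof.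
split=> [v a u w | u a v w]; rewrite /double_form.
  rewrite (linearP (v.2 : 'Hom(g, K^o))) lfunE /= lfunE /= mulrDr.
  by rewrite -!addrA; congr (_ + _); rewrite addrCA.
rewrite (linearP (u.2 : 'Hom(g, K^o))) lfunE /= lfunE /= mulrDr.
by rewrite -!addrA; congr (_ + _); rewrite addrCA.
Qed.
HB.instance Definition _ :=
  bilinear_isBilinear.Build K double_superspace double_superspace K _ _
    double_form
    double_form_bilinear.

Definition extends_double (L : lie_super g) (L' : lie_super (dual_superspace g))
    (H : lie_super double_superspace) :=
  [/\ forall x y, br H (x, 0) (y, 0) = (br L x y, 0),
      forall x, x \in odd_part g -> sq H (x, 0) = (sq L x, 0),
      forall f h, br H (0, f) (0, h) = (0, br L' f h)
    & forall f, f \in odd_part (dual_superspace g) ->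
        sq H (0, f) = (0, sq L' f)].

End Double.
Arguments double_form {K}.

(* Main.v *)
Require Import Defs.
From HB Require Import structures.
From mathcomp Require Import all_boot all_order all_algebra.

Set Implicit Arguments.
Unset Strict Implicit.
Unset Printing Implicit Defensive.

Import GRing.Theory.
Local Open Scope ring_scope.

(** Write [h] for the sum of [g] and its dual, with the canonical form [B].  The
    bracket is forced: [B([u, v], w)] has to be a symmetric trilinear form, so
    its values with two arguments in [g], or two in the dual, are prescribed by
    the two given structures ([double_br_uniq]).  Conversely the bracket with
    these values ([double_br], see [double_brE]) is bilinear, symmetric and
    makes [B] invariant by construction.  The three conditions are there for the
    Jacobi identity and the identity [[s(u), v] = [u, [u, v]]].

    For the Jacobi identity let [J(u, v, w)] be the cyclic sum of [[u, [v, w]]].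
    Invariance and symmetry of [B] make the quadrilinear form [B(J(u, v, w), z)]
    symmetric in all four arguments ([form_jac_swap]).  If three arguments lie
    in [g], or three in the dual, it vanishes since [J] vanishes in a Lie
    superalgebra of characteristic 2, whatever the parities ([br_jac]).  There
    remain two arguments [x, y] in [g] and two in the dual, that is, the
    [g]-component of [J(x, y, f)].  For homogeneous arguments its vanishing is
    [cond3], used as it stands or with [x] and [y] exchanged, except when [x]
    and [y] are odd and [f] is even; then it follows from [cond1] by
    polarization ([jac_inl_odd], [jac_inl2]).  The symmetry of the quadrilinear
    form then gives [J = 0] everywhere ([double_br_jac]).

    For the squaring, [s(x + f)] has to be [s(x) + s(f) + [x, f]], because the
    bracket polarizes it.  By [cond1] and [cond2], [s(x)] and [s(f)] act on [h]
    as the squares of the actions of [x] and [f] ([sq_ad_inl], [sq_ad_inr]), and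
    the cross term [[x, f]] is accounted for by the Jacobi identity
    ([double_sq_ad]). *)

(** * Vectors in characteristic 2 *)

Section CharTwo.
Variables (K : fieldType) (charK2 : 2%N \in [pchar K]) (V : lmodType K).

Lemma addvv (v : V) : v + v = 0.
Proof.
by rewrite -mulr2n -scaler_nat; case/andP: charK2 => _ /eqP ->; rewrite scale0r.
Qed.

Lemma oppv (v : V) : - v = v.
Proof. by apply/eqP; rewrite eq_sym -subr_eq0 opprK addvv. Qed.

Lemma addv_eq0 (u v : V) : u + v = 0 -> u = v.
Proof. by move/eqP; rewrite addr_eq0 oppv => /eqP. Qed.

End CharTwo.

(** * The Jacobiator of a bracket with an invariant form *)

Section Jacobiator.
Variables (K : fieldType) (V : vectType K) (b : {bilinear V -> V -> V}).

Definition jac x y z := b x (b y z) + b y (b z x) + b z (b x y).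

Lemma jac_rot x y z : jac x y z = jac y z x.
Proof. by rewrite /jac addrC addrA addrC !addrA. Qed.

Lemma jacD x x' y z : jac (x + x') y z = jac x y z + jac x' y z.
Proof.
rewrite /jac !(linearDl, linearDr) /=.
by rewrite (AC (2*2*2) ((1*3*5)*(2*4*6))).
Qed.

Lemma jacDm x y y' z : jac x (y + y') z = jac x y z + jac x y' z.
Proof. by rewrite jac_rot jacD -!(jac_rot x). Qed.

Lemma jacDr x y z z' : jac x y (z + z') = jac x y z + jac x y z'.
Proof. by rewrite jac_rot jacDm -!(jac_rot x). Qed.

Hypothesis b_sym : forall x y, b x y = b y x.

Lemma jac_swap x y z : jac x y z = jac y x z.
Proof.
rewrite /jac (b_sym z x) (b_sym y z) (b_sym x y).
by rewrite [b x _ + _]addrC.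
Qed.

Lemma jac_swapr x y z : jac x y z = jac x z y.
Proof. by rewrite jac_rot jac_swap -jac_rot. Qed.

(** If [p] and [q] act on [w] as the squares of [x] and [y], and
    [p + q + [x, y]] as the square of [x + y], then comparing the cross terms
    gives the Jacobi identity for [x], [y], [w]: this is how a squaring controls
    the bracket of two odd elements. *)
Lemma jac_polarized p q x y w : (forall v : V, v + v = 0) ->
    b p w = b x (b x w) -> b q w = b y (b y w) ->
    b (p + q + b x y) w = b (x + y) (b (x + y) w) ->
  jac x y w = 0.
Proof.
move=> addvv px qy; rewrite !(linearDl, linearDr) /= px qy.
rewrite -!addrA => /addrI; rewrite addrCA [in RHS]addrA [RHS]addrC => /addrI E.
by rewrite /jac [b w x]b_sym [b w (b x y)]b_sym E [b y (b x w) + _]addrC addvv.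
Qed.

Variable B : {biscalar V}.
Hypothesis B_sym : forall x y, B x y = B y x.
Hypothesis B_inv : forall x y z, B (b x y) z = B x (b y z).

(** By invariance [B (jac x y z) t] is the sum, over the three ways of splitting
    the four arguments into two pairs, of [B] applied to the brackets of the two
    pairs; together with [jac_rot] and [jac_swap] this exchange gives symmetry
    in all four arguments. *)
Lemma form_jac_swap x y z t : B (jac x y z) t = B (jac x y t) z.
Proof.
have flat u v w s : B (b u (b v w)) s = B (b v w) (b u s).
  by rewrite b_sym B_inv.
rewrite /jac !linearDl /= !flat.
rewrite (b_sym z x) (b_sym z t) [B (b y z) _]B_sym [B (b x z) _]B_sym.
by rewrite (b_sym t x) [X in X + _]addrC.
Qed.

End Jacobiator.

(** * Parity and duality *)

Section Parity.
Variable K : fieldType.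
Implicit Types V : superspace K.

(** Indexing the parts by a boolean, with parities adding up by [(+)], lets one
    statement cover all the parity axioms of a bracket. *)
Definition part V (i : bool) := if i then odd_part V else even_part V.

Lemma part_ind V (P : V -> Prop) :
    (forall x y, P x -> P y -> P (x + y)) ->
    (forall i x, x \in part V i -> P x) ->
  forall x, P x.
Proof.
move=> PD Ppart x.
have /memv_addP[y y0 [z z1 ->]] : x \in (even_part V + odd_part V)%VS.
  by rewrite even_odd_full memvf.
by apply: PD; [apply: (Ppart false) | apply: (Ppart true)].
Qed.

Lemma dual_sep (V : vectType K) (x y : V) :
  (forall f : 'Hom(V, K^o), f x = f y) -> x = y.
Proof.
by move=> xy; apply: bidual_inj; apply/lfunP=> f; rewrite !bidualE.
Qed.

Lemma mem_dual_part V i (f : 'Hom(V, K^o)) :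
  reflect (forall x, x \in part V (~~ i) -> f x = 0)
          (f \in part (dual_superspace V) i).
Proof. by case: i; apply: (iffP (annP _ _)). Qed.

(** Each part is its own double annihilator, so the parity of a vector can be
    read off the functionals; this is how the parity of [coad_dual] is found. *)
Lemma mem_partP V i (x : V) :
  reflect (forall f : 'Hom(V, K^o),
             f \in part (dual_superspace V) (~~ i) -> f x = 0)
          (x \in part V i).
Proof.
apply: (iffP idP) => [Vx f /mem_dual_part f0 | x0].
  by apply: f0; rewrite negbK.
have /memv_addP[y y0 [z z1 xE]] : x \in (part V i + part V (~~ i))%VS.
  have -> : (part V i + part V (~~ i))%VS = fullv.
    by case: (i); rewrite /= ?[(odd_part V + _)%VS]addvC even_odd_full.
  exact: memvf.
suff z0 : z = 0 by rewrite xE z0 addr0.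
apply: dual_sep; apply: (@part_ind (dual_superspace V)) => [f h fz hz | j f fj].
  by rewrite !lfunE /= fz hz !linear0 addr0.
rewrite linear0; have [ji | ji] := eqVneq j i.
  by move/mem_dual_part: fj; apply; rewrite ji.
have {ji} ji : j = ~~ i by case: (j) (i) ji => [] [].
move: fj; rewrite ji => fj; have := x0 _ fj.
rewrite xE linearD /=; move/mem_dual_part: fj => ->; first by rewrite add0r.
by rewrite negbK.
Qed.

End Parity.

(** * Identities valid in all parities in a Lie superalgebra *)

Section LieSuper.
Variables (K : fieldType) (charK2 : 2%N \in [pchar K]).
Variables (V : superspace K) (L : lie_super V).

Lemma br_part i j x y :
  x \in part V i -> y \in part V j -> br L x y \in part V (i (+) j).
Proof.
case: i j => [] [] /= xi yj.
- by rewrite (sq_polar L) // !rpredB ?sq_even ?rpredD.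
- by rewrite (br_two_sided L) // br_odd.
- exact: br_odd.
- exact: br_even.
Qed.

Lemma br_sym x y : br L x y = br L y x.
Proof.
move: x y; apply: part_ind => [x x' xE x'E y | i x xi y].
  by rewrite linearDl linearDr xE x'E.
move: y; apply: part_ind => [y y' yE y'E | j y yj].
  by rewrite linearDl linearDr yE y'E.
case: i j xi yj => [] [] /= xi yj.
- by rewrite !(sq_polar L) // addrAC [y + x]addrC.
- exact: br_two_sided.
- by rewrite [RHS](br_two_sided L).
apply: addv_eq0 => //.
have := br_alt L (rpredD xi yj); rewrite !(linearDl, linearDr) /=.
by rewrite !(br_alt L) // add0r addr0 addrC.
Qed.

Lemma sqD x y : x \in odd_part V -> y \in odd_part V ->
  sq L (x + y) = sq L x + sq L y + br L x y.
Proof.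
move=> x1 y1; rewrite (sq_polar L) // -[_ - _ - _]addrA -opprD.
by rewrite [RHS]addrC subrK.
Qed.

Lemma sq0 : sq L 0 = 0.
Proof.
by rewrite -[in LHS](scale0r 0) sqZ ?mem0v // expr0n scale0r.
Qed.

(** With at most one odd argument this is an axiom; two odd arguments fall under
    the polarized squaring identity, whatever the parity of the third. *)
Lemma br_jac x y z : jac (br L) x y z = 0.
Proof.
have jac_odd u v w :
    u \in odd_part V -> v \in odd_part V -> jac (br L) u v w = 0.
  move=> u1 v1; apply: (@jac_polarized _ _ _ br_sym (sq L u) (sq L v)).
  - exact: addvv.
  - exact: sq_ad.
  - exact: sq_ad.
  - by rewrite -sqD // (sq_ad L) ?rpredD.
have jac_even u v w :
    u \in even_part V -> v \in even_part V -> w \in odd_part V ->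
  jac (br L) u v w = 0.
  move=> u0 v0 w1; rewrite /jac [br L w (br L _ _)]br_sym (br_module L) //.
  by rewrite [br L w u]br_sym addrACA subrr addr0 addvv.
move: x y z; apply: part_ind => [x x' xE x'E y z | i x xi].
  by rewrite jacD xE x'E addr0.
apply: part_ind => [y y' yE y'E z | j y yj z].
  by rewrite jacDm yE y'E addr0.
move: z; apply: part_ind => [z z' zE z'E | k z zk].
  by rewrite jacDr zE z'E addr0.
case: i j k xi yj zk => [] [] [] /= xi yj zk; try exact: jac_odd.
- by rewrite -jac_rot jac_odd.
- by rewrite jac_rot jac_even.
- by rewrite jac_rot jac_odd.
- by rewrite -jac_rot jac_even.
- exact: jac_even.
- exact: (br_jacobi L).
Qed.
End LieSuper.

(** * The double: form, bracket and squaring *)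

Section DoubleBracket.
Variables (K : fieldType) (charK2 : 2%N \in [pchar K]).
Variables (g : superspace K).
Variables (L : lie_super g) (L' : lie_super (dual_superspace g)).
Local Notation double := (double_superspace g).
Local Notation dual := (dual_superspace g).
Local Notation B := (double_form g).
Implicit Types (u v w : double) (x y z : g) (f h : dual).

Lemma double_form_sym u v : B u v = B v u.
Proof. exact: addrC. Qed.

Lemma double_form_sep u v : (forall w, B u w = B v w) -> u = v.
Proof.
case: u v => [x f] [y h] E; congr (_, _).
  apply: dual_sep => k; have := E (0, k); rewrite /double_form /=.
  by rewrite !linear0 !addr0.
apply/lfunP=> z; have := E (z, 0); rewrite /double_form /=.
by rewrite !lfunE /= !add0r.
Qed.

Lemma double_form_nondeg : nondegenerate_form B.
Proof.
have sep u : (forall v, B u v = 0) -> u = 0.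
  by move=> u0; apply: double_form_sep => v; rewrite u0 linear0l.
by split=> // u u0; apply: sep => v; apply: etrans (u0 v); apply: addrC.
Qed.

Lemma double_form_even : even_form B.
Proof.
move=> u v; rewrite !mem_prodv => /andP[u0 f0] /andP[v1 f1].
have z : B u v = 0.
  by rewrite /double_form (annP _ _ f1) // (annP _ _ f0) // addr0.
by split=> //; apply: etrans z; apply: addrC.
Qed.

Definition double_br u v : double :=
  (br L u.1 v.1 + coad_dual L' v.1 u.2 + coad_dual L' u.1 v.2,
   br L' u.2 v.2 + coad L u.2 v.1 + coad L v.2 u.1).

(** The right-hand side is symmetric in [u], [v], [w]; symmetry, invariance and
    linearity of [double_br] are all read off from it. *)
Lemma double_brE u v w : B (double_br u v) w =
  (w.2 : 'Hom(g, K^o)) (br L u.1 v.1) + (u.2 : 'Hom(g, K^o)) (br L v.1 w.1)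
    + (v.2 : 'Hom(g, K^o)) (br L u.1 w.1)
  + ((br L' u.2 v.2 : 'Hom(g, K^o)) w.1 + (br L' u.2 w.2 : 'Hom(g, K^o)) v.1
    + (br L' v.2 w.2 : 'Hom(g, K^o)) u.1).
Proof.
rewrite /double_form /= !linearD /= !coad_dualE !add_lfunE !coadE.
by rewrite (AC (3*3) ((1*5*6)*(4*2*3))).
Qed.

Lemma double_br_sym u v : double_br u v = double_br v u.
Proof.
apply: double_form_sep => w; rewrite !double_brE.
rewrite (br_sym charK2 L v.1 u.1) (br_sym charK2 L' v.2 u.2).
by congr (_ + _); rewrite addrAC.
Qed.

Fact double_br_linearl v : linear (double_br^~ v).
Proof.
move=> a u u'; apply: double_form_sep => w.
rewrite linearPl /= !double_brE /= !linearPl /= !linearP.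
rewrite !add_lfunE !scale_lfunE !mulrDr.
by rewrite (AC ((2*2*2)*(2*2*2)) ((1*3*5*(7*9*11))*(2*4*6*(8*10*12)))).
Qed.

Fact double_br_bilinear : bilinear_for *:%R *:%R double_br.
Proof.
split=> [|u a v v']; first exact: double_br_linearl.
by rewrite !(double_br_sym u) double_br_linearl.
Qed.
HB.instance Definition _ :=
  bilinear_isBilinear.Build K double double double _ _
    double_br double_br_bilinear.

Lemma double_br_inv u v w : B (double_br u v) w = B u (double_br v w).
Proof.
rewrite [RHS]double_form_sym !double_brE.
rewrite (br_sym charK2 L w.1 u.1) (br_sym charK2 L v.1 u.1).
rewrite (br_sym charK2 L' w.2 u.2) (br_sym charK2 L' v.2 u.2).
by congr (_ + _); [rewrite -addrA addrC addrAC | rewrite addrC addrA];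
  rewrite // addrAC.
Qed.

Lemma double_part i u :
  (u \in part double i) = (u.1 \in part g i) && (u.2 \in part dual i).
Proof. by case: i; apply: mem_prodv. Qed.

Lemma coad_part i j f x :
  f \in part dual i -> x \in part g j -> coad L f x \in part dual (i (+) j).
Proof.
move=> fi xj; apply/mem_dual_part=> y yk; rewrite coadE.
move/mem_dual_part: fi; apply.
have -> : ~~ i = j (+) ~~ (i (+) j) by case: (i) (j) => [] [].
exact: br_part.
Qed.

Lemma coad_dual_part i j x f :
  x \in part g i -> f \in part dual j -> coad_dual L' x f \in part g (i (+) j).
Proof.
move=> xi fj; apply/mem_partP=> h hk; rewrite coad_dualE.
have : br L' f h \in part dual (~~ i).
  have -> : ~~ i = j (+) ~~ (i (+) j) by case: (i) (j) => [] [].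
  exact: br_part.
by move/mem_dual_part; apply; rewrite negbK.
Qed.

Lemma double_br_part i j u v :
  u \in part double i -> v \in part double j ->
  double_br u v \in part double (i (+) j).
Proof.
rewrite !double_part => /andP[u1 u2] /andP[v1 v2].
apply/andP; split; rewrite !rpredD ?br_part //.
- by rewrite addbC coad_dual_part.
- exact: coad_dual_part.
- exact: coad_part.
by rewrite addbC coad_part.
Qed.

Local Notation inl x := ((x, 0) : double).
Local Notation inr f := ((0, f) : double).

Lemma double_split u : u = inl u.1 + inr u.2.
Proof. by case: u => x f; congr (_, _); rewrite /= (addr0, add0r). Qed.

Lemma inlD x y : inl (x + y) = inl x + inl y.
Proof. by congr (_, _); rewrite addr0. Qed.

Lemma inrD f h : inr (f + h) = inr f + inr h.
Proof. by congr (_, _); rewrite addr0. Qed.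

Lemma inlZ a x : inl (a *: x) = a *: inl x.
Proof. by congr (_, _); rewrite scaler0. Qed.

Lemma inrZ a f : inr (a *: f) = a *: inr f.
Proof. by congr (_, _); rewrite scaler0. Qed.

Lemma coad0l x : coad L 0 x = 0.
Proof. by apply/lfunP=> y; rewrite coadE !lfunE. Qed.

Lemma coad0r f : coad L f 0 = 0.
Proof. by apply/lfunP=> y; rewrite coadE linear0l linear0 lfunE. Qed.

Lemma coad_dual0l f : coad_dual L' 0 f = 0.
Proof. by apply: dual_sep=> h; rewrite coad_dualE !linear0. Qed.

Lemma coad_dual0r x : coad_dual L' x 0 = 0.
Proof. by apply: dual_sep=> h; rewrite coad_dualE linear0l linear0 lfunE. Qed.

Lemma double_br_inl x u :
  double_br (inl x) u = (br L x u.1 + coad_dual L' x u.2, coad L u.2 x).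
Proof.
by rewrite /double_br /= coad_dual0r coad0l linear0l /= !(add0r, addr0).
Qed.

Lemma double_br_inr f u :
  double_br (inr f) u = (coad_dual L' u.1 f, br L' f u.2 + coad L f u.1).
Proof.
by rewrite /double_br /= coad_dual0l coad0r linear0l /= !(add0r, addr0).
Qed.

Lemma double_br_inll x y : double_br (inl x) (inl y) = inl (br L x y).
Proof. by rewrite double_br_inl coad_dual0r coad0l addr0. Qed.

Lemma double_br_inrr f h : double_br (inr f) (inr h) = inr (br L' f h).
Proof. by rewrite double_br_inr coad_dual0l coad0r addr0. Qed.

Lemma double_br_inlr x f :
  double_br (inl x) (inr f) = (coad_dual L' x f, coad L f x).
Proof. by rewrite double_br_inl linear0 add0r. Qed.

Lemma jac_inl3 x y z : jac double_br (inl x) (inl y) (inl z) = 0.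
Proof.
rewrite /jac /= !double_br_inll.
by congr (_, _); [exact: br_jac | rewrite /= !addr0].
Qed.

Lemma jac_inr3 f h k : jac double_br (inr f) (inr h) (inr k) = 0.
Proof.
rewrite /jac /= !double_br_inrr.
by congr (_, _); [rewrite /= !addr0 | exact: (br_jac charK2 L')].
Qed.

(** Pairing [[x, f]] with an element of [g] and using invariance leaves a bracket
    of two elements of [g]; pairing it with a functional leaves one of two
    functionals.  Nondegeneracy then determines [[x, f]]. *)
Lemma double_br_uniq (b : {bilinear double -> double -> double}) :
    (forall u v, b u v = b v u) ->
    (forall u v w, B (b u v) w = B u (b v w)) ->
    (forall x y, b (inl x) (inl y) = double_br (inl x) (inl y)) ->
    (forall f h, b (inr f) (inr h) = double_br (inr f) (inr h)) ->
  forall u v, b u v = double_br u v.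
Proof.
move=> b_sym b_inv b_inl b_inr.
have mixed x f : b (inl x) (inr f) = double_br (inl x) (inr f).
  apply: double_form_sep => w; rewrite (double_split w) !linearDr /=.
  congr (_ + _); last by rewrite b_inv double_br_inv b_inr.
  rewrite b_sym (double_br_sym (inl x)).
  by rewrite b_inv double_br_inv b_inl.
move=> u v; rewrite (double_split u) (double_split v) !(linearDl, linearDr) /=.
rewrite b_inl b_inr mixed b_sym mixed.
by rewrite [double_br (inr _) (inl _)]double_br_sym.
Qed.

Definition double_sq u : double :=
  (sq L u.1 + coad_dual L' u.1 u.2, sq L' u.2 + coad L u.2 u.1).

Lemma double_sqE u : double_sq u =
  inl (sq L u.1) + inr (sq L' u.2) + double_br (inl u.1) (inr u.2).
Proof. by rewrite double_br_inlr; congr (_, _); rewrite /= (addr0, add0r). Qed.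

Lemma double_sq_even u :
  u \in odd_part double -> double_sq u \in even_part double.
Proof.
rewrite (double_part true) => /andP[x1 f1]; rewrite (double_part false) /=.
apply/andP; split.
  by apply: rpredD; [exact: sq_even | exact: (@coad_dual_part true true)].
by apply: rpredD; [exact: (sq_even L') | exact: (@coad_part true true)].
Qed.

Lemma double_sqZ a u :
  u \in odd_part double -> double_sq (a *: u) = a ^+ 2 *: double_sq u.
Proof.
rewrite (double_part true) => /andP[x1 f1]; rewrite !double_sqE /=.
rewrite !sqZ // !inlZ !inrZ linearZl_LR linearZr_LR /= !scalerDr scalerA.
by [].
Qed.

Lemma double_sqD u v : u \in odd_part double -> v \in odd_part double ->
  double_sq (u + v) = double_sq u + double_sq v + double_br u v.
Proof.
rewrite !(double_part true) => /andP[x1 f1] /andP[y1 h1].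
have -> : double_br u v =
    (double_br (inl u.1) (inl v.1) + double_br (inr u.2) (inr v.2))
    + (double_br (inl u.1) (inr v.2) + double_br (inl v.1) (inr u.2)).
  rewrite {1}(double_split u) {1}(double_split v) !(linearDl, linearDr) /=.
  rewrite (double_br_sym (inl v.1)).
  by rewrite (AC (2*2) ((1*4)*(2*3))).
rewrite !double_sqE /= (sqD L x1 y1) (sqD L' f1 h1) !inlD !inrD.
rewrite double_br_inll double_br_inrr !(linearDl, linearDr) /=.
by rewrite (AC (3*3*(2*2)) ((1*4*7)*(2*5*10)*(3*6*(8*9)))).
Qed.

Lemma double_sq_polar u v : u \in odd_part double -> v \in odd_part double ->
  double_br u v = double_sq (u + v) - double_sq u - double_sq v.
Proof.
move=> u1 v1; rewrite double_sqD // -addrA -opprD.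
by rewrite [_ + double_br u v]addrC addrK.
Qed.

Lemma double_br_alt u : u \in even_part double -> double_br u u = 0.
Proof.
rewrite (double_part false) => /andP[x0 f0].
by rewrite /double_br (br_alt L) // (br_alt L') // !add0r !addvv.
Qed.

(** * Consequences of the compatibility conditions *)

Section Compatible.

Hypothesis cond1 : forall (x : g) (h : dual), x \in odd_part g ->
  coad_dual L' (sq L x) h =
    br L x (coad_dual L' x h) + coad_dual L' x (coad L h x).
Hypothesis cond2 : forall (y : g) (f : dual), f \in odd_part dual ->
  coad L (sq L' f) y = br L' f (coad L f y) + coad L f (coad_dual L' y f).
Hypothesis cond3 : forall (x y : g) (f : dual),
  [\/ x \in even_part g /\ y \in even_part g,
      x \in even_part g /\ f \in even_part dual
    | x \in odd_part g /\ f \in odd_part dual] ->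
  br L (coad_dual L' x f) y =
    coad_dual L' y (coad L f x) + br L x (coad_dual L' y f)
      + coad_dual L' x (coad L f y) + coad_dual L' (br L x y) f.

(** Applied to a functional [h], the two sides have equal [g]-components by
    [cond1], and equal dual components because [h] is composed with the same
    identity in [g]. *)
Lemma sq_ad_inl x u : x \in odd_part g ->
  double_br (inl (sq L x)) u = double_br (inl x) (double_br (inl x) u).
Proof.
move=> x1; rewrite !double_br_inl /= linearDr /= (sq_ad L) // cond1 // addrA.
by congr (_, _); apply/lfunP=> y; rewrite !coadE (sq_ad L).
Qed.

Lemma sq_ad_inr f u : f \in odd_part dual ->
  double_br (inr (sq L' f)) u = double_br (inr f) (double_br (inr f) u).
Proof.
move=> f1; rewrite !double_br_inr /= linearDr /= (sq_ad L') // cond2 // addrA.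
by congr (_, _); apply: dual_sep => h; rewrite !coad_dualE (sq_ad L').
Qed.

Lemma jac_inl_odd x y u : x \in odd_part g -> y \in odd_part g ->
  jac double_br (inl x) (inl y) u = 0.
Proof.
move=> x1 y1.
apply: (@jac_polarized _ _ _ double_br_sym (inl (sq L x)) (inl (sq L y))).
- exact: addvv.
- exact: sq_ad_inl.
- exact: sq_ad_inl.
by rewrite /= double_br_inll -!inlD -(sqD L) // sq_ad_inl ?rpredD.
Qed.

(** The [g]-component is [cond3]; the dual component is [f] composed with the
    Jacobi identity of [g]. *)
Lemma jac_inl2_hom x y f :
    [\/ x \in even_part g /\ y \in even_part g,
        x \in even_part g /\ f \in even_part dual
      | x \in odd_part g /\ f \in odd_part dual] ->
  jac double_br (inl x) (inl y) (inr f) = 0.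
Proof.
move=> /cond3 xyf; rewrite /jac /= [double_br (inr f) (inl x)]double_br_sym.
rewrite [double_br (inr f) _]double_br_sym double_br_inll.
rewrite !double_br_inlr !double_br_inl /=; congr (_, _) => /=.
  rewrite (br_sym charK2 L y) (AC (2*2*1) (3*(4*1*2*5))) /= xyf; exact: addvv.
apply/lfunP=> z; rewrite !add_lfunE !coadE lfunE /=.
rewrite -[RHS](linear0 (f : 'Hom(g, K^o))) -(br_jac charK2 L x y z).
rewrite /jac !linearD /=.
rewrite (br_sym charK2 L z x) (br_sym charK2 L z (br L x y)).
by rewrite [X in X + _ = _]addrC.
Qed.

(** The parities are [i], [j], [k] for [x], [y], [f].  Both [x] and [y] odd is
    settled by [cond1].  Otherwise [cond3] applies, after exchanging [x] and
    [y] if necessary: when they have different parities, the one of the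
    parity of [f] has to come first. *)
Lemma jac_inl2 x y f : jac double_br (inl x) (inl y) (inr f) = 0.
Proof.
move: x y f; apply: part_ind => [x x' xE x'E y f | i x xi].
  by rewrite inlD jacD xE x'E addr0.
apply: part_ind => [y y' yE y'E f | j y yj].
  by rewrite inlD jacDm yE y'E addr0.
apply: (@part_ind _ dual) => [f h fE hE | k f fk].
  by rewrite inrD jacDr fE hE addr0.
case: i j k xi yj fk => [] [] [] /= xi yj fk.
- by apply: jac_inl2_hom; apply: Or33.
- exact: jac_inl_odd.
- by apply: jac_inl2_hom; apply: Or33.
- by rewrite (jac_swap double_br_sym); apply: jac_inl2_hom; apply: Or32.
- by rewrite (jac_swap double_br_sym); apply: jac_inl2_hom; apply: Or33.
- by apply: jac_inl2_hom; apply: Or32.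
- by apply: jac_inl2_hom; apply: Or31.
- by apply: jac_inl2_hom; apply: Or31.
Qed.

(** By symmetry of the quadrilinear form, pairing with an element of [g] reduces
    this to two arguments in [g], and pairing with a functional to three in the
    dual. *)
Lemma jac_inr2 x f h : jac double_br (inl x) (inr f) (inr h) = 0.
Proof.
have inv := form_jac_swap double_br_sym double_form_sym double_br_inv.
apply: double_form_sep => w; rewrite (double_split w) linear0l linearDr /=.
rewrite [X in X + _]inv (jac_swapr double_br_sym) jac_inl2 linear0l add0r.
by rewrite jac_rot inv jac_inr3 linear0l.
Qed.

Lemma double_br_jac u v w : jac double_br u v w = 0.
Proof.
have J2 x y w' : jac double_br (inl x) (inl y) w' = 0.
  by rewrite (double_split w') jacDr jac_inl3 jac_inl2 addr0.
have J1 x v' w' : jac double_br (inl x) v' w' = 0.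
  rewrite (double_split v') jacDm J2 add0r (double_split w') jacDr jac_inr2.
  by rewrite addr0 (jac_swapr double_br_sym) J2.
rewrite (double_split u) jacD J1 add0r (double_split v) jacDm.
rewrite (jac_swap double_br_sym) J1 add0r (double_split w) jacDr jac_inr3 addr0.
by rewrite -jac_rot J1.
Qed.

Lemma double_sq_ad u v : u \in odd_part double ->
  double_br (double_sq u) v = double_br u (double_br u v).
Proof.
rewrite (double_part true) => /andP[x1 f1]; rewrite double_sqE !linearDl /=.
rewrite sq_ad_inl // sq_ad_inr //.
set w := double_br (double_br _ _) v.
rewrite [u in RHS]double_split !(linearDl, linearDr) /=.
(* The cross terms [x, [f, v]] + [f, [x, v]] add up to [[x, f], v]. *)
have J := double_br_jac (inl u.1) (inr u.2) v.
rewrite /jac /= [double_br v (inl _)]double_br_sym in J.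
rewrite [double_br v _]double_br_sym in J; have {J} wE := addv_eq0 charK2 J.
by rewrite /w -wE (AC (2*2) ((1*3)*(4*2))).
Qed.

Lemma double_br_derivation u v w :
  double_br (double_br u v) w =
    double_br u (double_br v w) - double_br v (double_br u w).
Proof.
rewrite oppv //; have := double_br_jac u v w; rewrite /jac /=.
rewrite [double_br w u]double_br_sym [double_br w _]double_br_sym.
by move/(addv_eq0 charK2) => ->.
Qed.

Definition double_lie : lie_super double := LieSuper
  (@double_br_part false false) double_br_alt
  (fun u v w _ _ _ => double_br_jac u v w)
  (@double_br_part false true)
  (fun u v w _ _ _ => double_br_derivation u v w)
  (fun u v _ _ => double_br_sym v u)
  double_sq_even double_sqZ double_sq_polar
  (fun u v => @double_sq_ad u v).

End Compatible.
End DoubleBracket.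

Theorem theorem3p1p1 (K : fieldType) (charK2 : 2%N \in [pchar K])
    (g : superspace K) (L : lie_super g) (L' : lie_super (dual_superspace g))
    (cond1 : forall (x : g) (h : dual_superspace g), x \in odd_part g ->
       coad_dual L' (sq L x) h =
         br L x (coad_dual L' x h) + coad_dual L' x (coad L h x))
    (cond2 : forall (y : g) (f : dual_superspace g),
       f \in odd_part (dual_superspace g) ->
       coad L (sq L' f) y =
         br L' f (coad L f y) + coad L f (coad_dual L' y f))
    (cond3 : forall (x y : g) (f : dual_superspace g),
       [\/ x \in even_part g /\ y \in even_part g,
           x \in even_part g /\ f \in even_part (dual_superspace g)
         | x \in odd_part g /\ f \in odd_part (dual_superspace g)] ->
       br L (coad_dual L' x f) y =
         coad_dual L' y (coad L f x) + br L x (coad_dual L' y f)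
           + coad_dual L' x (coad L f y) + coad_dual L' (br L x y) f) :
  exists H : lie_super (double_superspace g),
    [/\ extends_double L L' H,
        NIS H (double_form g),
        forall H' : lie_super (double_superspace g),
          extends_double L L' H' -> NIS H' (double_form g) ->
          same_lie_super H H',
        (forall (x y : g) (f h : dual_superspace g),
           br H (x, f) (y, h) =
             (br L x y + coad_dual L' y f + coad_dual L' x h,
              br L' f h + coad L f y + coad L h x)) /\
        (forall (x : g) (f : dual_superspace g),
           x \in odd_part g -> f \in odd_part (dual_superspace g) ->
           sq H (x, f) =
             (sq L x + coad_dual L' x f, sq L' f + coad L f x))
      & even_form (double_form g) /\
        invariant_form H (double_form g)].
Proof.
have dbr_inv := double_br_inv charK2 L L'.
exists (double_lie charK2 cond1 cond2 cond3); split.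
- split=> [x y | x x1 | f h | f f1] /=.
  + exact: double_br_inll.
  + by rewrite /double_sq /= coad_dual0r coad0l sq0 !addr0.
  + exact: double_br_inrr.
  + by rewrite /double_sq /= coad_dual0l coad0r sq0 !addr0.
- split; [exact: double_form_nondeg | exact: dbr_inv | split].
    exact: double_form_sym.
  by move=> u _; apply: (addrr_pchar2 charK2).
- move=> H' [br_l sq_l br_r sq_r] [_ H'_inv _].
  have brE u v : br H' u v = double_br L L' u v.
    apply: double_br_uniq => //; first exact: br_sym.
      by move=> x y; rewrite br_l double_br_inll.
    by move=> f h; rewrite br_r double_br_inrr.
  split=> [u v | u u1] /=; first by rewrite brE.
  move: (u1); rewrite (double_part true) => /andP[x1 f1].
  rewrite double_sqE [u in RHS]double_split.
  rewrite (sqD H') ?sq_l ?sq_r ?brE //.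
    by rewrite (double_part true) x1 /= mem0v.
  by rewrite (double_part true) f1 mem0v.
- by split.
by split; [exact: double_form_even | exact: dbr_inv].
Qed.
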